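(* Let $(x^{(r)})_{r\ge 0}$ be generated by the cyclic block coordinate descent (BCD) method with exact block minimization applied to $$\min_{x_k\in X_k,\ k=1,\dots,K}\ f(x)=\tfrac12\Big\|\sum_{k=1}^K A_kx_k-b\Big\|^2+\sum_{k=1}^K h_k(x_k),$$ and let $\Delta^{(r)}=f(x^{(r)})-f^*$, where $f^*$ is the optimal value. Then for all $r\ge0$: 1. If each $A_k$ has full column rank, with $\lambda_{\min}(A_k^TA_k)\ge\sigma_k^2$ for constants $\sigma_k>0$, and $\sigma_{\min}=\min_k\sigma_k$, then $$\Delta^{(r+1)}\le 3\max\left\{\Delta^{(0)},\ 2R_0^2\,\frac{1}{\sigma_{\min}^2}\log^2(2NK)\,(L^2+L_{\max}^2)\right\}\frac{1}{r+1}.$$ 2. If each $A_k$ has full row rank, with $\lambda_{\min}(A_kA_k^T)\ge\gamma_k^2$ for constants $\gamma_k>0$, and $\gamma_{\min}=\min_k\gamma_k$, then $$\Delta^{(r+1)}\le 3\max\left\{\Delta^{(0)},\ 2R_0^2\,\frac{1}{\gamma_{\min}^2}\log^2(2NK)\,(L^2+L_{\max}^2)\right\}\frac{1}{r+1}.$$ 3. If each $A_k$ has neither full column rank nor full row rank, then $$\Delta^{(r+1)}\le 3\max\left\{\Delta^{(0)},\ 2R_0^2\,L_{\max}(1+K^2)\right\}\frac{1}{r+1}.$$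
   Context: Here $A_k\in\mathbb{R}^{M\times N}$, $b\in\mathbb{R}^M$, $x=(x_1,\dots,x_K)$ with blocks $x_k\in\mathbb{R}^N$, each $X_k\subseteq\mathbb{R}^N$ is a nonempty closed convex set, $X=X_1\times\cdots\times X_K$, and each $h_k:X_k\to\mathbb{R}$ is convex and lower semicontinuous (possibly nonsmooth). Write $g(x)=\frac12\|\sum_kA_kx_k-b\|^2$ and $A=[A_1,\dots,A_K]$. $L=\lambda_{\max}(A^TA)$ is the Lipschitz constant of $\nabla g$, $L_k=\lambda_{\max}(A_k^TA_k)$, $L_{\max}=\max_kL_k$. $\log$ is the natural logarithm and $\|\cdot\|$ the Euclidean norm. Cyclic BCD: starting from $x^{(0)}\in X$, at iteration $r+1$, for $k=1,\dots,K$ successively, choose $$x_k^{(r+1)}\in\arg\min_{x_k\in X_k}\ g\big(x_1^{(r+1)},\dots,x_{k-1}^{(r+1)},x_k,x_{k+1}^{(r)},\dots,x_K^{(r)}\big)+h_k(x_k),$$ (any minimizer; minimizers are assumed to exist but need not be unique). $X^*$ is the set of optimal solutions, assumed nonempty, and $R_0=\max_{x\in X}\max_{x^*\in X^*}\{\|x-x^*\| : f(x)\le f(x^{(0)})\}$, assumed finite. *)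

(* Defs.v *)
From mathcomp Require Import all_boot all_order all_algebra.
From mathcomp Require Import all_classical all_reals all_analysis.
Import Order.TTheory GRing.Theory Num.Theory.
Import numFieldNormedType.Exports.

Set Implicit Arguments.
Unset Strict Implicit.
Unset Printing Implicit Defensive.

Local Open Scope classical_set_scope.
Local Open Scope ring_scope.

(* The library norm on matrices is the max norm, hence this definition. *)
Definition enorm (R : realType) (n : nat) (v : 'cV[R]_n) : R :=
  Num.sqrt (\sum_i v i ord0 ^+ 2).

(* Extreme real eigenvalues; meaningful for symmetric matrices of positive
   size, whose spectrum is real, finite and nonempty. *)
Definition lambda_max (R : realType) (n : nat) (B : 'M[R]_n) : R :=
  sup [set a | eigenvalue B a].

Definition lambda_min (R : realType) (n : nat) (B : 'M[R]_n) : R :=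
  inf [set a | eigenvalue B a].

(* Used with K > 0 only: the range is then finite and nonempty, so that its
   sup (inf) is a maximum (minimum). *)
Definition max_blk (R : realType) (K : nat) (s : 'I_K -> R) : R := sup (range s).

Definition min_blk (R : realType) (K : nat) (s : 'I_K -> R) : R := inf (range s).

Section problem.
Variables (R : realType) (M N K : nat).
Variables (A : 'I_K -> 'M[R]_(M, N)) (b : 'cV[R]_M).
Variables (X : 'I_K -> set 'cV[R]_N) (h : 'I_K -> 'cV[R]_N -> R).

Local Notation point := ('I_K -> 'cV[R]_N).

Definition quad (x : point) : R :=
  2^-1 * enorm (\sum_k A k *m x k - b) ^+ 2.

(* Only the values of h k on X k are ever constrained or used. *)
Definition obj (x : point) : R := quad x + \sum_k h k (x k).

Definition feasible : set point := [set x | forall k, X k (x k)].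

Definition optval : R := inf (obj @` feasible).

Definition optimal : set point :=
  [set x | feasible x /\ forall y, feasible y -> obj x <= obj y].

Definition blk_dist (x y : point) : R := enorm (\mxcol_k (x k - y k)).

Definition R0_set (x0 : point) : set R :=
  [set d | exists x xs : point,
     [/\ feasible x, optimal xs, obj x <= obj x0 & d = blk_dist x xs]].

(* Under bcd_assumptions, once R0_set x0 is nonempty and bounded it has a maximum:
   the sublevel set and the optimal set are compact. *)
Definition R0_radius (x0 : point) : R := sup (R0_set x0).

Definition argmin (D : set 'cV[R]_N) (phi : 'cV[R]_N -> R) : set 'cV[R]_N :=
  [set u | D u /\ forall v, D v -> phi u <= phi v].

Definition bcd_point (new old : point) (k : 'I_K) (u : 'cV[R]_N) : point :=
  fun j => if (j < k)%N then new j else if j == k then u else old j.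

Definition cyclic_bcd (x : nat -> point) : Prop :=
  feasible (x 0%N) /\
  forall r k, argmin (X k)
    (fun u => quad (bcd_point (x r.+1) (x r) k u) + h k u) (x r.+1 k).

Definition gap (x : nat -> point) (r : nat) : R := obj (x r) - optval.

Definition lip : R :=
  let B := \mxrow_(k < K) A k in lambda_max (B^T *m B).

Definition lip_max : R := max_blk (fun k => lambda_max ((A k)^T *m A k)).

(* Lower semicontinuity is relative to X k (subspace topology). *)
Definition bcd_assumptions : Prop :=
  [/\ forall k, X k !=set0, forall k, closed (X k),
      forall k, convex_set (X k), forall k, convex_function (X k) (h k) &
      forall k, lower_semicontinuous (fun u : subspace (X k) => (h k u)%:E)].

End problem.

(* Main.v *)
(** Testing the block optimality conditions of one sweep against an optimal
    point bounds the gap by a strictly block-triangular sum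
      [S = \sum_(k < j) <A_k z_k, A_j y_j>],
    where [z = x^(r+1) - x*] and [y = x^(r+1) - x^(r)]; tested against
    [x^(r)] they give the descent [1/2 \sum_k |A_k y_k|^2].  Hence any estimate
    [2 S^2 <= C \sum_k |A_k y_k|^2] yields
      [Delta(r+1)^2 <= C (Delta(r) - Delta(r+1))]
    and the 1/r rate.  The three cases are three estimates of [S]:
    - full column rank: halve the index range recursively; [S] is the sum of
      [up_log 2 K] levels of off-diagonal blocks of [A^T A], each of norm at most
      [L / 2], and [up_log 2 K / 2 <= ln (2 N K)];
    - full row rank: [|\sum_(k < j) A_k z_k|^2 <= L |z|^2] gives
      [S^2 <= K L |z|^2 \sum_k |A_k y_k|^2], and [K gamma^2 <= L];
    - no rank condition: termwise Cauchy-Schwarz with [|A_k z_k|^2 <= Lmax |z_k|^2]. *)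
Require Import Defs.
From mathcomp Require Import all_boot all_order all_algebra.
From mathcomp Require Import all_classical all_reals all_analysis.
From mathcomp Require Import zify ring lra.
Import Order.TTheory GRing.Theory Num.Theory.
Import numFieldNormedType.Exports.

Local Open Scope classical_set_scope.
Local Open Scope ring_scope.

Set Implicit Arguments.
Unset Strict Implicit.

(** Lets [t] tend to 0 in first-order conditions, once a quadratic perturbation has been divided by
    [t]. *)
Lemma ge0_affine_limit (R : realType) (a c : R) :
  (forall t, 0 < t <= 1 -> 0 <= a + t * c) -> 0 <= a.
Proof.
move=> H; rewrite leNgt; apply/negP => a0.
have d0 : 0 < `|c| - a by rewrite subr_gt0 (lt_le_trans a0).
(* At this [t] even [a + t * |c|] equals [- a ^+ 2 / (|c| - a)], which is negative. *)
have t0 : 0 < - a / (`|c| - a) by rewrite divr_gt0// oppr_gt0.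
have /H : 0 < - a / (`|c| - a) <= 1.
  by rewrite t0 ler_pdivrMr// mul1r lerDr normr_ge0.
apply/negP; rewrite -ltNge.
apply: (@le_lt_trans _ _ (a + - a / (`|c| - a) * `|c|)).
  by rewrite lerD2l ler_wpM2l ?ler_norm ?ltW.
have -> : a + - a / (`|c| - a) * `|c| = - (a ^+ 2 / (`|c| - a)).
  by field; rewrite gt_eqF.
by rewrite oppr_lt0 divr_gt0// exprn_even_gt0//= lt_eqF.
Qed.

(** * Euclidean dot product *)

Section DotProduct.
Context {R : realType}.

Definition dot n (u v : 'cV[R]_n) : R := (u^T *m v) 0 0.

Lemma dotE n (u v : 'cV[R]_n) : dot u v = \sum_i u i 0 * v i 0.
Proof. by rewrite /dot mxE; apply: eq_bigr => i _; rewrite mxE. Qed.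

Lemma dotC n (u v : 'cV[R]_n) : dot u v = dot v u.
Proof. by rewrite !dotE; apply: eq_bigr => i _; rewrite mulrC. Qed.

Lemma dotDr n (u v w : 'cV[R]_n) : dot u (v + w) = dot u v + dot u w.
Proof. by rewrite /dot mulmxDr mxE. Qed.

Lemma dotNr n (u v : 'cV[R]_n) : dot u (- v) = - dot u v.
Proof. by rewrite /dot mulmxN mxE. Qed.

Lemma dotZr n a (u v : 'cV[R]_n) : dot u (a *: v) = a * dot u v.
Proof. by rewrite /dot -scalemxAr mxE. Qed.

Lemma dotDl n (u v w : 'cV[R]_n) : dot (v + w) u = dot v u + dot w u.
Proof. by rewrite dotC dotDr !(dotC u). Qed.

Lemma dotNl n (u v : 'cV[R]_n) : dot (- v) u = - dot v u.
Proof. by rewrite dotC dotNr dotC. Qed.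

Lemma dotZl n a (u v : 'cV[R]_n) : dot (a *: v) u = a * dot v u.
Proof. by rewrite dotC dotZr dotC. Qed.

Definition dotDNZ := (dotDl, dotDr, dotNl, dotNr, dotZl, dotZr).

Lemma dot_sumr n (I : finType) (P : pred I) (u : 'cV[R]_n) F :
  dot u (\sum_(i | P i) F i) = \sum_(i | P i) dot u (F i).
Proof. by rewrite /dot mulmx_sumr summxE. Qed.

Lemma dot_suml n (I : finType) (P : pred I) (u : 'cV[R]_n) F :
  dot (\sum_(i | P i) F i) u = \sum_(i | P i) dot (F i) u.
Proof. by rewrite dotC dot_sumr; apply: eq_bigr => i _; rewrite dotC. Qed.

Lemma dot_mulmx m n (A : 'M[R]_(m, n)) u v : dot u (A *m v) = dot (A^T *m u) v.
Proof. by rewrite /dot trmx_mul trmxK mulmxA. Qed.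

Lemma dot_ge0 n (u : 'cV[R]_n) : 0 <= dot u u.
Proof. by rewrite dotE sumr_ge0// => i _; rewrite -expr2 sqr_ge0. Qed.

Lemma dot_eq0 n (u : 'cV[R]_n) : dot u u = 0 -> u = 0.
Proof.
rewrite dotE => /psumr_eq0P H; apply/colP => i; rewrite mxE.
have /eqP := H (fun i _ => ltac:(by rewrite -expr2 sqr_ge0)) i isT.
by rewrite mulf_eq0 => /orP[]/eqP.
Qed.

Lemma enorm_sqr n (u : 'cV[R]_n) : enorm u ^+ 2 = dot u u.
Proof.
rewrite /enorm sqr_sqrtr; last by rewrite sumr_ge0// => i _; rewrite sqr_ge0.
by rewrite dotE; apply: eq_bigr => i _; rewrite expr2.
Qed.

Lemma dot_le_half n (u v : 'cV[R]_n) :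
  dot u v <= 2^-1 * (dot u u + dot v v).
Proof.
have := dot_ge0 (u - v); rewrite !dotDNZ (dotC v u); lra.
Qed.

Lemma dot_mxcol K (p : 'I_K -> nat) (u v : forall k, 'cV[R]_(p k)) :
  dot (\mxcol_k u k) (\mxcol_k v k) = \sum_k dot (u k) (v k).
Proof. by rewrite /dot tr_mxcol mul_mxrow_mxcol summxE. Qed.

End DotProduct.

(** * Rayleigh quotients *)

Section Rayleigh.
Context {R : realType}.

Lemma quadratic_form_continuous n (B : 'M[R]_n) :
  continuous (fun w : 'rV[R]_n => dot w^T (B *m w^T)).
Proof.
have -> : (fun w : 'rV[R]_n => dot w^T (B *m w^T)) =
    (fun w => \sum_i \sum_j w 0 i * (B i j * w 0 j)).
  apply/funext => w; rewrite dotE; apply: eq_bigr => i _.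
  rewrite !mxE big_distrr; by apply: eq_bigr => j _; rewrite !mxE.
have coord i : continuous (fun w : 'rV[R]_n => w 0 i) by exact: coord_continuous.
apply: continuous_big => [|i _]; first exact: add_continuous.
apply: continuous_big => [|j _]; first exact: add_continuous.
move=> w; have FF : Filter (nbhs w) by exact: nbhs_filter.
apply: (@cvgM _ _ (nbhs w) _ (fun w => w 0 i) (fun w => B i j * w 0 j)).
  exact: coord.
by apply: (@cvgM _ _ (nbhs w) _ (fun=> B i j)); [exact: cvg_cst|exact: coord].
Qed.

(** The form attains a maximum [mu] on the compact unit sphere; homogeneity extends the bound to all
    vectors, and stationarity makes the maximizer an eigenvector. *)
Lemma rayleigh_max n (B : 'M[R]_n.+1) : B^T = B ->
  exists2 mu, eigenvalue B mu & forall w, dot w (B *m w) <= mu * dot w w.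
Proof.
move=> symB; pose S := [set w : 'rV[R]_n.+1 | dot w^T w^T = 1].
have Sdelta : S (delta_mx 0 0).
  rewrite /S/= dotE (bigD1 0)//= !mxE/= mulr1 big1 ?addr0// => i i0.
  by rewrite !mxE (negbTE i0) andbF mulr0.
have bndS : bounded_set S.
  exists 1; split=> // M M1 w Sw.
  rewrite /= [leLHS]/Num.norm/= mx_normrE; apply/bigmax_leP; split=> [|[i j] _ /=].
    by rewrite ltW// (lt_trans ltr01).
  rewrite (le_trans _ (ltW M1))// -(@expr_le1 _ 2)// real_normK ?num_real//.
  rewrite -Sw dotE (bigD1 j)//= !mxE (ord1 i) -expr2 lerDl.
  by rewrite sumr_ge0// => k _; rewrite -expr2 sqr_ge0.
have clS : closed S.
  have -> : S = (fun w : 'rV[R]_n.+1 => dot w^T (1%:M *m w^T)) @^-1` [set 1].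
    by apply/funext => w; rewrite /S/= mul1mx.
  apply: preimage_closed; last exact: closed_eq.
  by move=> w _; exact: quadratic_form_continuous.
have [|v /[!inE] Sv vmax] :=
    compact_EVT_max (ex_intro _ _ Sdelta) (bounded_closed_compact bndS clS)
      (f := fun w => dot w^T (B *m w^T)).
  by apply: continuous_subspaceT; exact: quadratic_form_continuous.
have [mu Dmu] : exists mu, dot v^T (B *m v^T) = mu by eexists.
rewrite Dmu in vmax.
have ray w : dot w (B *m w) <= mu * dot w w.
  have [->|w0] := eqVneq w 0; first by rewrite mulmx0 /dot !mulmx0 mxE mulr0.
  have ww : 0 < dot w w.
    by rewrite lt_neqAle dot_ge0 eq_sym andbT; apply: contra_neq w0 => /dot_eq0.
  have s0 : Num.sqrt (dot w w) != 0 by rewrite gt_eqF// sqrtr_gt0.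
  have := vmax ((Num.sqrt (dot w w))^-1 *: w^T).
  rewrite /S inE/= linearZ/= trmxK -scalemxAr !dotDNZ !mulrA -invfM -expr2.
  rewrite sqr_sqrtr ?(ltW ww)// mulVf ?gt_eqF// mulrC => /(_ erefl).
  by rewrite ler_pdivrMr.
exists mu => //; apply/eigenvalueP; exists v; last first.
  apply/eqP => v0; move: Sv; rewrite /S/= v0 trmx0 /dot mulmx0 mxE => /eqP.
  by rewrite eq_sym oner_eq0.
(* Moving from the maximizer by [t *: r], along its own eigenvector defect, turns
   [mu |w|^2 - <w, B w>] from 0 into [- 2 t |r|^2 + O(t^2)]. This stays nonnegative, so [r = 0]. *)
have [r Dr] : exists r, r = B *m v^T - mu *: v^T by eexists.
suff /dot_eq0/eqP : dot r r = 0.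
  rewrite Dr subr_eq0 => /eqP /(congr1 trmx).
  by rewrite trmx_mul symB linearZ/= !trmxK.
apply/eqP; rewrite eq_le dot_ge0 andbT -oppr_ge0 -(pmulr_rge0 _ (ltr0Sn R 1)).
apply: (@ge0_affine_limit _ _ (mu * dot r r - dot r (B *m r))) => t /andP[t0 _].
rewrite -(pmulr_rge0 _ t0).
have := ray (v^T + t *: r); rewrite mulmxDr -scalemxAr !dotDNZ -subr_ge0.
have -> : dot v^T (B *m r) = dot r (B *m v^T) by rewrite dot_mulmx symB dotC.
rewrite Sv Dmu (dotC v^T r).
have -> : dot r (B *m v^T) = dot r r + mu * dot r v^T.
  by rewrite {3}Dr !dotDNZ; ring.
congr (0 <= _); ring.
Qed.

Lemma eigenvalue_dot n (B : 'M[R]_n) a : B^T = B -> eigenvalue B a ->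
  exists2 w, 0 < dot w w & dot w (B *m w) = a * dot w w.
Proof.
move=> symB /eigenvalueP[v vB v0]; exists v^T.
  rewrite lt_neqAle dot_ge0 eq_sym andbT; apply: contra_neq v0 => /dot_eq0 vT.
  by rewrite -[v]trmxK vT trmx0.
by rewrite -{1}symB -trmx_mul vB linearZ/= dotZr.
Qed.

(** The [mu] of [rayleigh_max] is an eigenvalue, and it bounds the spectrum because every eigenvalue
    is a Rayleigh quotient. In dimension 0 both sides vanish. *)
Lemma quadratic_form_le_lambda_max n (B : 'M[R]_n) w : B^T = B ->
  dot w (B *m w) <= lambda_max B * dot w w.
Proof.
case: n B w => [B w _|n B w symB].
  by rewrite [w]flatmx0 /dot !mulmx0 mxE mulr0.
have [mu muB ray] := rayleigh_max symB.
apply: (le_trans (ray w)); rewrite ler_wpM2r ?dot_ge0//.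
apply: ub_le_sup => //; exists mu => a /(eigenvalue_dot symB)[u u0 uE].
by rewrite -(ler_pM2r u0) -uE.
Qed.

Lemma eigenvalueN n (B : 'M[R]_n) a : eigenvalue (- B) a -> eigenvalue B (- a).
Proof.
move=> /eigenvalueP[v vB v0]; apply/eigenvalueP; exists v => //.
by rewrite scaleNr -vB mulmxN opprK.
Qed.

Lemma lambda_min_le_quadratic_form n (B : 'M[R]_n) w : B^T = B ->
  lambda_min B * dot w w <= dot w (B *m w).
Proof.
case: n B w => [B w _|n B w symB].
  by rewrite [w]flatmx0 /dot !mulmx0 mxE mulr0.
have [|mu /eigenvalueN muB ray] := @rayleigh_max _ (- B).
  by rewrite linearN/= symB.
have {}ray u : - mu * dot u u <= dot u (B *m u).
  by have := ray u; rewrite mulNmx dotNr mulNr lerNl.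
apply: le_trans (ray w); rewrite ler_wpM2r ?dot_ge0//.
apply: ge_inf => //; exists (- mu) => a /(eigenvalue_dot symB)[u u0 uE].
by rewrite -(ler_pM2r u0) -uE.
Qed.

Lemma gram_le_lambda_max m n (A : 'M[R]_(m, n)) w :
  dot (A *m w) (A *m w) <= lambda_max (A^T *m A) * dot w w.
Proof.
rewrite dot_mulmx mulmxA dotC.
by apply: quadratic_form_le_lambda_max; rewrite trmx_mul trmxK.
Qed.

Lemma lambda_min_le_gram m n (A : 'M[R]_(m, n)) w :
  lambda_min (A^T *m A) * dot w w <= dot (A *m w) (A *m w).
Proof.
rewrite dot_mulmx mulmxA (dotC _ w).
by apply: lambda_min_le_quadratic_form; rewrite trmx_mul trmxK.
Qed.

Lemma lambda_max_gram_ge0 m n (A : 'M[R]_(m, n)) : 0 <= lambda_max (A^T *m A).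
Proof.
have [v|noeig] := pselect (exists v : 'cV[R]_n, v != 0).
  case: v => v v0.
  have vv : 0 < dot v v.
    by rewrite lt_neqAle dot_ge0 eq_sym andbT; apply: contra_neq v0 => /dot_eq0.
  rewrite -(ler_pM2r vv) mul0r; apply: le_trans (gram_le_lambda_max _ _).
  exact: dot_ge0.
(* In dimension 0 the spectrum is empty, and [sup] of the empty set is 0 by default. *)
rewrite /lambda_max (_ : [set a | _] = set0) ?sup0//.
apply/seteqP; split=> // a /= /eigenvalueP[v _ v0]; apply: noeig.
by exists v^T; apply: contra_neq v0 => /(congr1 trmx); rewrite trmxK trmx0.
Qed.

(** A discriminant argument: take [(t, u) = (b, s)] if [b > 0], and [(s, a + 1)] if [b = 0]. It
    turns additive estimates of a bilinear quantity into product estimates by rescaling the two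
    arguments. *)
Lemma sqr_le_of_quadratic (s a b : R) :
  (forall t u, 2 * (t * u * s) <= t ^+ 2 * a + u ^+ 2 * b) -> s ^+ 2 <= a * b.
Proof.
move=> H; have a0 : 0 <= a by have := H 1 0; lra.
have b0 : 0 <= b by have := H 0 1; lra.
have [b_eq0|b_neq0] := eqVneq b 0.
  have := H s (a + 1); rewrite b_eq0 => Hs; have := sqr_ge0 s; nra.
rewrite -(@ler_pM2r _ b) ?lt_neqAle 1?eq_sym ?b_neq0//.
have := H b s; nra.
Qed.

Lemma dot_cauchy_schwarz n (u v : 'cV[R]_n) :
  dot u v ^+ 2 <= dot u u * dot v v.
Proof.
apply: sqr_le_of_quadratic => t s.
have := dot_le_half (t *: u) (s *: v); rewrite !dotDNZ; lra.
Qed.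

(** A matrix and its transpose have the same norm: [|v|^4 = <u, A v>^2 <= |u|^2 |A v|^2 <= L |u|^2
    |v|^2], divided by [|v|^2]. *)
Lemma gram_trmx_le_lambda_max m n (A : 'M[R]_(m, n)) u :
  dot (A^T *m u) (A^T *m u) <= lambda_max (A^T *m A) * dot u u.
Proof.
set v := A^T *m u; set L := lambda_max _.
have [vv0|vv_neq0] := eqVneq (dot v v) 0.
  by rewrite vv0 mulr_ge0 ?lambda_max_gram_ge0 ?dot_ge0.
have vv : 0 < dot v v by rewrite lt_neqAle dot_ge0 eq_sym vv_neq0.
rewrite -(ler_pM2r vv).
have -> : dot v v * dot v v = dot u (A *m v) ^+ 2 by rewrite dot_mulmx expr2.
apply: (le_trans (dot_cauchy_schwarz _ _)).
by rewrite [L * _]mulrC -mulrA ler_wpM2l ?dot_ge0 ?gram_le_lambda_max.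
Qed.

End Rayleigh.

(** * Strictly triangular sums *)

Section BlockTriangularSums.
Context {R : realType} {K : nat}.

Lemma big_interval_split (a c b : nat) (f : 'I_K -> R) : (a <= c <= b)%N ->
  \sum_(k < K | (a <= k < b)%N) f k =
  \sum_(k < K | (a <= k < c)%N) f k + \sum_(k < K | (c <= k < b)%N) f k.
Proof.
move=> /andP[ac cb]; rewrite (bigID (fun k : 'I_K => (k < c)%N))/=.
by congr (_ + _); apply: eq_bigl => k; lia.
Qed.

(** A pair [k < j] in a window either lies in one half or straddles the midpoint. Straddling pairs
    form a rectangle, bounded by [HF]; the windows of one level are disjoint, so each of the [n]
    levels costs [C] once. *)
Lemma dyadic_triangular_sum (F : 'I_K -> 'I_K -> R) (p q : 'I_K -> R) (C : R) :
  0 <= C -> (forall k, 0 <= p k) -> (forall k, 0 <= q k) ->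
  (forall P Q : pred 'I_K, (forall k, P k -> ~~ Q k) ->
    \sum_(j | Q j) \sum_(k | P k) F k j <=
    C * (\sum_(k | P k) p k + \sum_(j | Q j) q j)) ->
  forall n a, \sum_(j < K | (a <= j < a + 2 ^ n)%N)
                \sum_(k < K | (a <= k < j)%N) F k j <=
    n%:R * C * (\sum_(k < K | (a <= k < a + 2 ^ n)%N) p k
                + \sum_(j < K | (a <= j < a + 2 ^ n)%N) q j).
Proof.
move=> C0 p0 q0 HF; elim=> [|n IHn] a.
  rewrite !mul0r big1// => j aj; rewrite big_pred0// => k; lia.
have split_a : (a <= a + 2 ^ n <= a + 2 ^ n.+1)%N by rewrite expnS; lia.
have Dc : (a + 2 ^ n.+1 = a + 2 ^ n + 2 ^ n)%N by rewrite expnS; lia.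
rewrite !(big_interval_split _ split_a) Dc.
rewrite [X in _ + X <= _](_ : _ =
    \sum_(j < K | (a + 2 ^ n <= j < a + 2 ^ n + 2 ^ n)%N)
      \sum_(k < K | (a <= k < a + 2 ^ n)%N) F k j +
    \sum_(j < K | (a + 2 ^ n <= j < a + 2 ^ n + 2 ^ n)%N)
      \sum_(k < K | (a + 2 ^ n <= k < j)%N) F k j); last first.
  rewrite -big_split; apply: eq_bigr => j cj.
  by rewrite (@big_interval_split a (a + 2 ^ n)) //; lia.
have := IHn a; have := IHn (a + 2 ^ n)%N.
set m := (2 ^ n)%N.
have := HF (fun k => (a <= k < a + m)%N) (fun k => (a + m <= k < a + m + m)%N).
move=> /(_ (fun k => ltac:(lia))).
(* The rectangle pays only for [p] on the left half and [q] on the right half; these two nonnegative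
   sums complete it to the whole window. *)
have : 0 <= C * \sum_(k < K | (a + m <= k < a + m + m)%N) p k.
  by rewrite mulr_ge0 ?sumr_ge0.
have : 0 <= C * \sum_(k < K | (a <= k < a + m)%N) q k.
  by rewrite mulr_ge0 ?sumr_ge0.
rewrite -natr1; lra.
Qed.

(** With [e k = A k *m z k] and [d j = A j *m y j] this is the sum [S] of the overview. *)
Definition cross_sum n (e d : 'I_K -> 'cV[R]_n) : R :=
  \sum_(j < K) \sum_(k < K | (k < j)%N) dot (e k) (d j).

Lemma cross_sumZ n t u (e d : 'I_K -> 'cV[R]_n) :
  cross_sum (fun k => t *: e k) (fun k => u *: d k) = t * u * cross_sum e d.
Proof.
rewrite /cross_sum big_distrr; apply: eq_bigr => j _; rewrite big_distrr.
by apply: eq_bigr => k _; rewrite /= !dotDNZ; ring.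
Qed.

Lemma sum_dotZ n t (e : 'I_K -> 'cV[R]_n) :
  \sum_k dot (t *: e k) (t *: e k) = t ^+ 2 * \sum_k dot (e k) (e k).
Proof.
by rewrite big_distrr; apply: eq_bigr => k _; rewrite /= !dotDNZ; ring.
Qed.

(** Each term obeys [2 <e_k, d_j> <= |e_k|^2 + |d_j|^2]; extending the right-hand side to all [K^2]
    pairs makes each square occur [K] times. *)
Lemma cross_sum_le_card n (e d : 'I_K -> 'cV[R]_n) :
  cross_sum e d ^+ 2 <=
  (K%:R * \sum_k dot (e k) (e k)) * (K%:R * \sum_k dot (d k) (d k)).
Proof.
have add (f g : 'I_K -> 'cV[R]_n) : 2 * cross_sum f g <=
    K%:R * (\sum_k dot (f k) (f k)) + K%:R * (\sum_k dot (g k) (g k)).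
  have -> : K%:R * (\sum_k dot (f k) (f k)) + K%:R * (\sum_k dot (g k) (g k))
      = \sum_(j < K) \sum_(k < K) (dot (f k) (f k) + dot (g j) (g j)).
    under [RHS]eq_bigr do rewrite big_split /= sumr_const card_ord.
    by rewrite big_split /= sumr_const card_ord sumrMnl !mulr_natl.
  rewrite big_distrr/=; apply: ler_sum => j _.
  rewrite big_distrr/= [leLHS]big_mkcond/=; apply: ler_sum => k _.
  have := dot_le_half (f k) (g j).
  have := dot_ge0 (f k); have := dot_ge0 (g j).
  by case: ifP => _; lra.
apply: sqr_le_of_quadratic => t u.
by rewrite -cross_sumZ mulrCA [_ ^+ 2 * (_ * _)]mulrCA -!sum_dotZ.
Qed.

End BlockTriangularSums.

(** * Estimates through the norm of the concatenated matrix *)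

Section BlockMatrices.
Context {R : realType} {M N K : nat}.
Variable A : 'I_K -> 'M[R]_(M, N).
Implicit Types z y : 'I_K -> 'cV[R]_N.

Lemma block_sum_le_lip z :
  dot (\sum_k A k *m z k) (\sum_k A k *m z k) <=
  lip A * \sum_k dot (z k) (z k).
Proof. by rewrite -dot_mxcol -mul_mxrow_mxcol; exact: gram_le_lambda_max. Qed.

Lemma block_trmx_sum_le_lip u :
  \sum_k dot ((A k)^T *m u) ((A k)^T *m u) <= lip A * dot u u.
Proof.
rewrite -dot_mxcol -mxcol_mul -tr_mxrow; exact: gram_trmx_le_lambda_max.
Qed.

Lemma lip_ge0 : 0 <= lip A.
Proof. exact: lambda_max_gram_ge0. Qed.

(** Apply the full bound to the point whose blocks outside [P] are set to zero. *)
Lemma block_sum_cond_le_lip (P : pred 'I_K) z :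
  dot (\sum_(k | P k) A k *m z k) (\sum_(k | P k) A k *m z k) <=
  lip A * \sum_(k | P k) dot (z k) (z k).
Proof.
have := block_sum_le_lip (fun k => if P k then z k else 0).
rewrite [X in dot X _](_ : _ = \sum_(k | P k) A k *m z k); last first.
  by rewrite [RHS]big_mkcond; apply: eq_bigr => k _; case: ifP; rewrite ?mulmx0.
rewrite [X in dot _ X](_ : _ = \sum_(k | P k) A k *m z k); last first.
  by rewrite [RHS]big_mkcond; apply: eq_bigr => k _; case: ifP; rewrite ?mulmx0.
rewrite [X in _ * X](_ : _ = \sum_(k | P k) dot (z k) (z k))//.
rewrite [RHS]big_mkcond; apply: eq_bigr => k _; case: ifP => // _.
by rewrite /dot mulmx0 mxE.
Qed.

(** For fixed [j] the inner sum collapses to one dot product of [g j] with a partial block sum,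
    whose square is at most [lip A] times the full [|w|^2]; summing over [j] produces the factor
    [K]. *)
Lemma cross_sum_le_lip z (d : 'I_K -> 'cV[R]_M) :
  cross_sum (fun k => A k *m z k) d ^+ 2 <=
  (K%:R * lip A * \sum_k dot (z k) (z k)) * \sum_k dot (d k) (d k).
Proof.
have add w (g : 'I_K -> 'cV[R]_M) : 2 * cross_sum (fun k => A k *m w k) g <=
    K%:R * lip A * (\sum_k dot (w k) (w k)) + \sum_k dot (g k) (g k).
  have -> : K%:R * lip A * (\sum_k dot (w k) (w k)) =
      \sum_(j < K) lip A * (\sum_k dot (w k) (w k)).
    by rewrite sumr_const card_ord -mulrA mulr_natl.
  rewrite -big_split/=.
  rewrite big_distrr/=; apply: ler_sum => j _.
  rewrite -dot_suml.
  have := dot_le_half (\sum_(k < K | (k < j)%N) A k *m w k) (g j).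
  have := block_sum_cond_le_lip (fun k => (k < j)%N) w.
  have : lip A * (\sum_(k < K | (k < j)%N) dot (w k) (w k)) <=
      lip A * \sum_k dot (w k) (w k).
    rewrite ler_wpM2l ?lip_ge0// [leLHS]big_mkcond/=; apply: ler_sum => k _.
    by case: ifP => // _; exact: dot_ge0.
  lra.
apply: sqr_le_of_quadratic => t u.
rewrite -cross_sumZ mulrCA -!sum_dotZ.
rewrite (_ : (fun k => t *: (A k *m z k)) = fun k => A k *m (t *: z k))//.
by apply/funext => k; rewrite scalemxAr.
Qed.

(* The factor 1/4 comes from polarization: [4 <u, v> <= |u + v|^2], and by
   disjointness [u + v] is [A] applied to a single block vector. *)
Lemma dot_block_sums_le (P Q : pred 'I_K) z y : (forall k, P k -> ~~ Q k) ->
  dot (\sum_(k | P k) A k *m z k) (\sum_(j | Q j) A j *m y j) <=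
  lip A / 4 * (\sum_(k | P k) dot (z k) (z k) + \sum_(j | Q j) dot (y j) (y j)).
Proof.
move=> PQ; set u := \sum_(k | P k) _; set v := \sum_(j | Q j) _.
have := block_sum_le_lip (fun k => if P k then z k else if Q k then y k else 0).
have Duv : \sum_k A k *m (if P k then z k else if Q k then y k else 0) = u + v.
  rewrite /u /v [X in _ = X + _]big_mkcond [X in _ = _ + X]big_mkcond -big_split.
  apply: eq_bigr => k _ /=; have := PQ k.
  by case: (P k) => [/(_ isT)/negbTE->|_]; [|case: (Q k)];
    rewrite ?addr0 ?add0r ?mulmx0.
rewrite Duv.
rewrite [X in _ <= _ * X](_ : _ =
    \sum_(k | P k) dot (z k) (z k) + \sum_(j | Q j) dot (y j) (y j)).
  have := dot_ge0 (u - v); rewrite !dotDNZ (dotC v u).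
  by move: (lip A) => L; lra.
rewrite [X in _ = X + _]big_mkcond [X in _ = _ + X]big_mkcond -big_split.
have dot0 : dot (0 : 'cV[R]_N) 0 = 0 by rewrite /dot mulmx0 mxE.
apply: eq_bigr => k _ /=; have := PQ k.
by case: (P k) => [/(_ isT)/negbTE->|_]; [|case: (Q k)];
  rewrite ?addr0 ?add0r ?dot0.
Qed.

Lemma cross_sum_le_log z y :
  cross_sum (fun k => A k *m z k) (fun k => A k *m y k) ^+ 2 <=
  ((up_log 2 K)%:R * lip A / 2) ^+ 2 *
  (\sum_k dot (z k) (z k)) * \sum_k dot (y k) (y k).
Proof.
set c := _ / 2.
have add w v : 2 * cross_sum (fun k => A k *m w k) (fun k => A k *m v k) <=
    c * (\sum_k dot (w k) (w k)) + c * (\sum_k dot (v k) (v k)).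
  have := @dyadic_triangular_sum _ _ (fun k j => dot (A k *m w k) (A j *m v j))
    (fun k => dot (w k) (w k)) (fun k => dot (v k) (v k)) (lip A / 4).
  rewrite divr_ge0 ?lip_ge0// => /(_ isT (fun=> dot_ge0 _) (fun=> dot_ge0 _)).
  move=> /(_ _ (up_log 2 K) 0%N); rewrite add0n => H.
  (* The window from 0 of length [2 ^ up_log 2 K >= K] covers all blocks. *)
  have full (f : 'I_K -> R) :
      \sum_(j < K | (0 <= j < 2 ^ up_log 2 K)%N) f j = \sum_j f j.
    by apply: eq_bigl => j; rewrite leq0n (leq_trans (ltn_ord j))// up_logP.
  move: H; rewrite !full => H.
  suff {H}/H : forall P Q : pred 'I_K, (forall k, P k -> ~~ Q k) ->
      \sum_(j | Q j) \sum_(k | P k) dot (A k *m w k) (A j *m v j) <=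
      lip A / 4 *
      (\sum_(k | P k) dot (w k) (w k) + \sum_(j | Q j) dot (v j) (v j)).
    by rewrite /c /cross_sum; lra.
  move=> P Q /(dot_block_sums_le w v); rewrite dot_sumr.
  by under eq_bigr do rewrite dot_suml.
have -> : forall p q, c ^+ 2 * p * q = (c * p) * (c * q) by move=> *; ring.
apply: sqr_le_of_quadratic => t u.
rewrite -cross_sumZ mulrCA [_ ^+ 2 * (_ * _)]mulrCA -!sum_dotZ.
rewrite (_ : (fun k => t *: (A k *m z k)) = fun k => A k *m (t *: z k)).
  rewrite (_ : (fun k => u *: (A k *m y k)) = fun k => A k *m (u *: y k))//.
  by apply/funext => k; rewrite scalemxAr.
by apply/funext => k; rewrite scalemxAr.
Qed.

End BlockMatrices.

(** The two off-diagonal triangles agree by symmetry of [dot]. *)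
Lemma expand_sum_sqr (R : realType) K n (d : 'I_K -> 'cV[R]_n) :
  dot (\sum_k d k) (\sum_k d k) = \sum_k dot (d k) (d k) + 2 * cross_sum d d.
Proof.
rewrite dot_sumr; under eq_bigr do rewrite dot_suml.
have -> : 2 * cross_sum d d =
    \sum_(j < K) \sum_(k < K | (k < j)%N) dot (d k) (d j)
    + \sum_(j < K) \sum_(k < K | (j < k)%N) dot (d k) (d j).
  rewrite [X in _ = _ + X](exchange_big_dep predT)//=.
  under [X in _ = _ + X]eq_bigr do under eq_bigr do rewrite dotC.
  by rewrite mulr_natl mulr2n.
rewrite -!big_split; apply: eq_bigr => j _ /=.
rewrite (bigD1 j)//=; congr (_ + _); rewrite (bigID (fun k : 'I_K => (k < j)%N))/=.
by congr (_ + _); apply: eq_bigl => k; rewrite -val_eqE/=; lia.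
Qed.

(** Induction with [B = max (Delta 0) C]; monotonicity gives the base case and allows [C] to be
    replaced by [B] in the recursion. *)
Lemma sublinear_rate (R : realType) (Delta : nat -> R) (C : R) :
  (forall r, 0 <= Delta r) -> (forall r, Delta r.+1 <= Delta r) ->
  (forall r, Delta r.+1 ^+ 2 <= C * (Delta r - Delta r.+1)) ->
  forall r, Delta r.+1 <= 3 * Num.max (Delta 0%N) C * (1 / r.+1%:R).
Proof.
move=> D0 Dmono Drec; set B := Num.max _ C.
have D0B : Delta 0%N <= B by rewrite le_max lexx.
have CB : C <= B by rewrite le_max lexx orbT.
have B0 : 0 <= B by apply: le_trans D0B.
have {}Drec r : Delta r.+1 ^+ 2 <= B * (Delta r - Delta r.+1).
  by apply: (le_trans (Drec r)); rewrite ler_wpM2r// subr_ge0.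
elim=> [|r IHr].
  by rewrite divr1 mulr1; have := Dmono 0%N; lra.
rewrite mulrA mulr1 ler_pdivlMr ?ltr0n//.
move: IHr; rewrite mulrA mulr1 ler_pdivlMr ?ltr0n//.
rewrite -[r.+2%:R]natr1; set s : R := r.+1%:R.
have s1 : 1 <= s by rewrite ler1n.
have := Drec r.+1; have := D0 r.+2; have := D0 r.+1.
move: (Delta r.+1) (Delta r.+2) => a t a0 t0 Hrec Has.
(* If [t (s + 1) > 3 B], then [(s + 1)^2 (s t^2 + s B t)] strictly exceeds [3 B^2 (s^2 + 4 s)],
   which is at least [3 B^2 (s + 1)^2] since [s >= 1]; this contradicts [H4]. *)
rewrite leNgt; apply/negP => Ht.
have H1 : s * t ^+ 2 + s * (B * t) <= 3 * B ^+ 2 by nra.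
have H2 : 3 * B * (3 * B) <= (t * (s + 1)) * (t * (s + 1)) by nra.
have H3 : B * (3 * B) <= B * (t * (s + 1)) by nra.
have H4 : (s + 1) ^+ 2 * (s * t ^+ 2 + s * (B * t)) <= 3 * B ^+ 2 * (s + 1) ^+ 2.
  by rewrite mulrC ler_wpM2r// sqr_ge0.
nra.
Qed.

(** * Extrema over the blocks *)

Section BlockExtrema.
Context {R : realType} {K : nat}.
Implicit Type s : 'I_K -> R.

Lemma le_max_blk s k : s k <= max_blk s.
Proof.
apply: ub_le_sup; last by exists k.
exists (\sum_j `|s j|) => _ [j _ <-].
by rewrite (bigD1 j)//= (le_trans (ler_norm _))// lerDl sumr_ge0.
Qed.

Lemma min_blk_le s k : min_blk s <= s k.
Proof.
apply: ge_inf; last by exists k.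
exists (- \sum_j `|s j|) => _ [j _ <-].
by rewrite lerNl (bigD1 j)//= (le_trans (ler_norm _))// normrN lerDl sumr_ge0.
Qed.

Lemma min_blk_gt0 s : (0 < K)%N -> (forall k, 0 < s k) -> 0 < min_blk s.
Proof.
move=> K0 s0.
have [m _ mmin] := Order.TotalTheory.arg_minP s (isT : xpredT (Ordinal K0)).
apply: (lt_le_trans (s0 m)); apply: lb_le_inf; first by exists (s m), m.
by move=> _ [k _ <-]; exact: mmin.
Qed.

End BlockExtrema.

(** Compare [u] with the feasible point [u + t (v - u)]: convexity handles [phi], the square
    contributes [t <B u + c, e> + t^2 |e|^2 / 2], and dividing by [t] leaves the first-order
    inequality. Only the quadratic part is differentiated. *)
Lemma argmin_variational (R : realType) m n (B : 'M[R]_(m, n)) (c : 'cV[R]_m)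
    (D : set 'cV[R]_n) (phi : 'cV[R]_n -> R) u v :
  convex_set D -> convex_function D phi ->
  argmin D (fun w => 2^-1 * enorm (B *m w + c) ^+ 2 + phi w) u -> D v ->
  phi u <= phi v + dot (B *m u + c) (B *m (v - u)).
Proof.
move=> cD cphi [Du umin] Dv; rewrite -subr_ge0.
pose e := B *m (v - u).
apply: (@ge0_affine_limit _ _ (2^-1 * dot e e)) => t /andP[t0 t1].
pose T := Itv01 (ltW t0) t1.
have Dw : D (t *: v + (1 - t) *: u).
  by have := cD v u T; rewrite !inE; apply.
have phiw : phi (t *: v + (1 - t) *: u) <= t * phi v + (1 - t) * phi u.
  by apply: (cphi T); rewrite inE.
have := umin _ Dw; rewrite !enorm_sqr.
have -> : B *m (t *: v + (1 - t) *: u) + c = (B *m u + c) + t *: e.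
  rewrite /e !mulmxDr mulmxN -!scalemxAr scalerBl scale1r scalerDr scalerN.
  by rewrite addrCA addrAC.
rewrite -/e -(pmulr_rge0 _ t0); move: (B *m u + c) e => a e'.
rewrite !dotDNZ (dotC e' a); nra.
Qed.

(** * Cyclic block coordinate descent *)

Section BCD.
Context {R : realType} {M N K : nat}.
Variables (A : 'I_K -> 'M[R]_(M, N)) (b : 'cV[R]_M).
Variables (X : 'I_K -> set 'cV[R]_N) (h : 'I_K -> 'cV[R]_N -> R).
Local Notation point := ('I_K -> 'cV[R]_N).
Implicit Types p q v : point.

Definition residual p : 'cV[R]_M := \sum_k A k *m p k - b.

Definition blockdiff p q (k : 'I_K) : 'cV[R]_M := A k *m (p k - q k).

Lemma quadE p : quad A b p = 2^-1 * dot (residual p) (residual p).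
Proof. by rewrite /quad enorm_sqr. Qed.

(** Isolates [u], so that the block subproblem has the form required by [argmin_variational].
    Measured from the new point [p], blocks after [k] still lag by [p j - q j]. *)
Lemma residual_bcd_point p q k u :
  residual (bcd_point p q k u) =
  A k *m u + (residual p - \sum_(j < K | (k < j)%N) A j *m (p j - q j)
              - A k *m p k).
Proof.
rewrite /residual.
have -> : \sum_j A j *m bcd_point p q k u j =
    A k *m u + (\sum_j A j *m p j - A k *m p k
                - \sum_(j < K | (k < j)%N) A j *m (p j - q j)).
  rewrite (bigD1 k)//= (bigD1 k (F := fun j => A j *m p j))//= /bcd_point ltnn eqxx.
  congr (_ + _); rewrite [A k *m p k + _]addrC addrK.
  rewrite [X in _ = _ - X](_ : _ = \sum_(j | j != k)
      (if (k < j)%N then A j *m (p j - q j) else 0)); last first.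
    rewrite [LHS]big_mkcond [RHS]big_mkcond; apply: eq_bigr => j _ /=.
    by case: eqVneq => [->|]; rewrite ?ltnn.
  rewrite -sumrB; apply: eq_bigr => j jk.
  rewrite (negbTE jk); case: ltngtP (jk) => [||/val_inj->]; rewrite ?eqxx//.
    by rewrite subr0.
  by rewrite mulmxBr opprB addrC subrK.
rewrite -[LHS]addrA; congr (_ + _).
rewrite -!addrA; congr (_ + _).
by rewrite addrCA [RHS]addrCA [- b - _]addrC.
Qed.

Hypothesis HX : bcd_assumptions X h.

(* Sum of the blockwise optimality conditions of a sweep from [q] to [p], tested
   against [v]; the gradient lag yields the strictly triangular cross terms. *)
Lemma bcd_sweep_bound p q v :
  (forall k, argmin (X k)
    (fun u => quad A b (bcd_point p q k u) + h k u) (p k)) ->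
  feasible X v ->
  obj A b h p + 2^-1 * dot (\sum_k blockdiff p v k) (\sum_k blockdiff p v k) <=
  obj A b h v + cross_sum (blockdiff p v) (blockdiff p q).
Proof.
move=> pmin Xv; set d := blockdiff p q; set e := blockdiff p v; have [_ _ cX ch _] := HX.
have blk k : h k (p k) <= h k (v k) -
    (dot (residual p) (e k) - \sum_(j < K | (k < j)%N) dot (e k) (d j)).
  have := @argmin_variational _ _ _ (A k)
    (residual p - \sum_(j < K | (k < j)%N) d j - A k *m p k) _ _ (p k) (v k)
    (cX k) (ch k) _ (Xv k).
  rewrite [A k *m p k + _]addrC subrK -(opprB (p k)) mulmxN dotNr.
  rewrite dotDl dotNl [dot (\sum_(j < K | _) _) _]dotC dot_sumr.
  apply; have [Xp pk] := pmin k; split=> // u Xu.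
  by have := pk _ Xu; rewrite !quadE !residual_bcd_point -!enorm_sqr.
have -> : cross_sum e d = \sum_(k < K) \sum_(j < K | (k < j)%N) dot (e k) (d j).
  by rewrite /cross_sum (exchange_big_dep predT).
(* The quadratic part is expanded exactly: [|r - s|^2 / 2] contains [|s|^2 / 2], which is the extra
   term kept on the left. *)
have Dv : residual v = residual p - \sum_k e k.
  rewrite /residual addrAC -sumrB; congr (_ - _); apply: eq_bigr => k _.
  by rewrite /e /blockdiff mulmxBr opprB addrC subrK.
have : \sum_k h k (p k) <= \sum_k (h k (v k) -
    (dot (residual p) (e k) - \sum_(j < K | (k < j)%N) dot (e k) (d j))).
  by apply: ler_sum => k _; exact: blk.
rewrite sumrB sumrB -dot_sumr /obj !quadE Dv.
move: (residual p) (\sum_k e k) => r s.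
rewrite !dotDNZ (dotC s r); lra.
Qed.

(** For [v = q] the cross sum on the right is exactly the off-diagonal part of the square on the
    left; after cancellation only the diagonal remains. *)
Lemma bcd_descent p q :
  (forall k, argmin (X k)
    (fun u => quad A b (bcd_point p q k u) + h k u) (p k)) ->
  feasible X q ->
  2^-1 * \sum_k dot (blockdiff p q k) (blockdiff p q k) <=
  obj A b h q - obj A b h p.
Proof.
by move=> pmin Xq; have := bcd_sweep_bound pmin Xq; rewrite expand_sum_sqr; lra.
Qed.

Lemma bcd_gap p q v :
  (forall k, argmin (X k)
    (fun u => quad A b (bcd_point p q k u) + h k u) (p k)) ->
  feasible X v ->
  obj A b h p - obj A b h v <=
  cross_sum (blockdiff p v) (blockdiff p q).
Proof.
move=> pmin Xv; have := bcd_sweep_bound pmin Xv.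
have := dot_ge0 (\sum_k blockdiff p v k); lra.
Qed.

Lemma optval_optimal v : optimal A b X h v -> optval A b X h = obj A b h v.
Proof.
move=> [Xv vmin]; apply/eqP; rewrite eq_le; apply/andP; split.
  apply: ge_inf; last by exists v.
  by exists (obj A b h v) => _ [y Xy <-]; exact: vmin.
apply: lb_le_inf; first by exists (obj A b h v), v.
by move=> _ [y Xy <-]; exact: vmin.
Qed.

Variable x : nat -> point.
Hypothesis Hx : cyclic_bcd A b X h x.

Lemma bcd_feasible r : feasible X (x r).
Proof.
case: r => [|r k]; first by case: Hx.
by have [_ /(_ r k)[]] := Hx.
Qed.

Lemma obj_bcd_decreasing r : obj A b h (x r.+1) <= obj A b h (x r).
Proof.
have := bcd_descent (Hx.2 r) (bcd_feasible r).
have : 0 <= \sum_k dot (blockdiff (x r.+1) (x r) k) (blockdiff (x r.+1) (x r) k).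
  by rewrite sumr_ge0// => k _; exact: dot_ge0.
lra.
Qed.

Lemma obj_bcd_le0 r : obj A b h (x r) <= obj A b h (x 0%N).
Proof.
by elim: r => // r IHr; apply: le_trans IHr; exact: obj_bcd_decreasing.
Qed.

Hypothesis HR0 : has_ubound (R0_set A b X h (x 0%N)).

(** Since the objective decreases, every iterate stays in the initial sublevel set. *)
Lemma bcd_dist_le_radius r v : optimal A b X h v ->
  \sum_k dot (x r k - v k) (x r k - v k) <= R0_radius A b X h (x 0%N) ^+ 2.
Proof.
move=> ov; rewrite -dot_mxcol -enorm_sqr -/(blk_dist (x r) v).
rewrite ler_sqr ?nnegrE ?sqrtr_ge0//; last first.
  apply: (@le_trans _ _ (blk_dist (x r) v)); first exact: sqrtr_ge0.
  apply: ub_le_sup => //; exists (x r), v; split=> //; first exact: bcd_feasible.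
  exact: obj_bcd_le0.
apply: ub_le_sup => //; exists (x r), v; split=> //; first exact: bcd_feasible.
exact: obj_bcd_le0.
Qed.

(** The gap is at most [S], and the descent lemma bounds the sum of squares by twice the decrease;
    the factor 2 in the hypothesis cancels the latter. *)
Lemma bcd_rate v C : optimal A b X h v ->
  (forall r, 2 * cross_sum (blockdiff (x r.+1) v) (blockdiff (x r.+1) (x r)) ^+ 2
    <= C * \sum_k dot (blockdiff (x r.+1) (x r) k) (blockdiff (x r.+1) (x r) k)) ->
  0 <= C ->
  forall r, gap A b X h x r.+1 <=
    3 * Num.max (gap A b X h x 0%N) C * (1 / r.+1%:R).
Proof.
move=> ov HC C0; have [Xv vmin] := ov; apply: sublinear_rate => r.
- by rewrite /gap (optval_optimal ov) subr_ge0; apply: vmin; exact: bcd_feasible.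
- by rewrite /gap lerD2r; exact: obj_bcd_decreasing.
rewrite /gap (optval_optimal ov).
have g0 : 0 <= obj A b h (x r.+1) - obj A b h v.
  by rewrite subr_ge0; apply: vmin; exact: bcd_feasible.
have gS := bcd_gap (Hx.2 r) Xv.
have des := bcd_descent (Hx.2 r) (bcd_feasible r).
have := HC r.
rewrite opprB addrA subrK.
move: (cross_sum _ _) (\sum_k _) gS des => S D gS des HS.
have H1 : (obj A b h (x r.+1) - obj A b h v) ^+ 2 <= S ^+ 2.
  by rewrite ler_sqr ?nnegrE// (le_trans g0).
have H2 := ler_wpM2l C0 des.
lra.
Qed.

End BCD.

(** * Logarithmic bounds and the row-rank estimate *)

Lemma ln2_ge_half (R : realType) : 2^-1 <= ln 2 :> R.
Proof.
(* Uses [ln (1 + x) <= x] at [x = - 1 / 2], where [1 + x] is the inverse of 2. *)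
have /le_ln1Dx : -1 < (- 2^-1 : R) by lra.
rewrite (_ : 1 + - 2^-1 = 2^-1 :> R); last by lra.
by rewrite lnV ?posrE//; lra.
Qed.

(** With [m = up_log 2 K], [m / 2 <= m ln 2 = ln (2 ^ m)], and minimality of [m] gives
    [2 ^ m <= 2 K] when [K > 1]. *)
Lemma half_up_log_le_ln (R : realType) (N K : nat) : (0 < N)%N -> (0 < K)%N ->
  (up_log 2 K)%:R / 2 <= ln (2 * N * K)%:R :> R.
Proof.
move=> N0 K0; apply: (@le_trans _ _ (ln (2 ^ up_log 2 K)%:R)).
  rewrite natrX lnXn// -[leRHS]mulr_natl ler_wpM2l//; exact: ln2_ge_half.
rewrite ler_ln ?posrE ?ltr0n ?expn_gt0 ?muln_gt0 ?N0 ?K0// ler_nat.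
have [K1|K_gt1] := leqP K 1.
  have -> : K = 1%N by lia.
  by rewrite up_log1; lia.
have := up_log_gtn (isT : 1 < 2)%N K_gt1.
have : (0 < up_log 2 K)%N by rewrite up_log_gt0.
case: (up_log 2 K) => // n _ /=; rewrite expnS; nia.
Qed.

Lemma ln_dbl_ge1 (R : realType) (N K : nat) : (0 < N)%N -> (1 < K)%N ->
  1 <= ln (2 * N * K)%:R :> R.
Proof.
move=> N0 K1; apply: (@le_trans _ _ (ln (2 ^ 2)%:R)).
  by rewrite natrX lnXn// mulr2n; have := ln2_ge_half R; lra.
by rewrite ler_ln ?posrE ?ltr0n ?ler_nat ?muln_gt0 ?N0; nia.
Qed.

Lemma cross_sum_single (R : realType) K n (e d : 'I_K -> 'cV[R]_n) :
  (K <= 1)%N -> cross_sum e d = 0.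
Proof.
move=> K1; rewrite /cross_sum big1// => j _; rewrite big_pred0// => k.
by have := ltn_ord k; have := ltn_ord j; lia.
Qed.

(** Test on a unit vector [u]: [K g <= \sum_k |A_k^T u|^2 <= L]. *)
Lemma lip_ge_card (R : realType) M N K (A : 'I_K -> 'M[R]_(M, N)) g :
  (0 < M)%N -> (forall k, g <= lambda_min (A k *m (A k)^T)) ->
  K%:R * g <= lip A.
Proof.
case: M A => // M A _ gA.
pose u : 'cV[R]_M.+1 := delta_mx 0 0.
have uu : dot u u = 1.
  rewrite dotE (bigD1 0)//= !mxE/= mulr1 big1 ?addr0// => i i0.
  by rewrite !mxE (negbTE i0) mulr0.
have := block_trmx_sum_le_lip A u; rewrite uu mulr1; apply: le_trans.
rewrite mulr_natl -[X in _ *+ X]card_ord -sumr_const; apply: ler_sum => k _.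
have := lambda_min_le_gram (A k)^T u; rewrite trmxK uu mulr1.
by apply: le_trans.
Qed.

Lemma rate_constant_ge0 (R : realType) (R0 s l L Lmax : R) :
  0 <= 2 * R0 ^+ 2 * (1 / s ^+ 2) * l ^+ 2 * (L ^+ 2 + Lmax ^+ 2).
Proof.
rewrite mulr_ge0 ?addr_ge0 ?sqr_ge0// mulr_ge0 ?sqr_ge0//.
by rewrite mulr_ge0 ?divr_ge0 ?sqr_ge0// mulr_ge0 ?sqr_ge0.
Qed.

Unset Implicit Arguments.

(** * The three convergence rates *)

Theorem theorem3p1 (R : realType) (M N K : nat)
    (M_gt0 : (0 < M)%N) (N_gt0 : (0 < N)%N) (K_gt0 : (0 < K)%N)
    (A : 'I_K -> 'M[R]_(M, N)) (b : 'cV[R]_M)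
    (X : 'I_K -> set 'cV[R]_N) (h : 'I_K -> 'cV[R]_N -> R)
    (x : nat -> 'I_K -> 'cV[R]_N) :
  bcd_assumptions X h ->
  optimal A b X h !=set0 ->
  cyclic_bcd A b X h x ->
  has_ubound (R0_set A b X h (x 0%N)) ->
  let Delta := gap A b X h x in
  let R0 := R0_radius A b X h (x 0%N) in
  let L := lip A in
  let Lmax := lip_max A in
  [/\ forall sigma : 'I_K -> R,
        (forall k, [/\ \rank (A k) = N, 0 < sigma k &
                       sigma k ^+ 2 <= lambda_min ((A k)^T *m A k)]) ->
        forall r : nat,
        Delta r.+1 <=
          3 * Num.max (Delta 0%N)
                (2 * R0 ^+ 2 * (1 / min_blk sigma ^+ 2)
                 * ln (2 * N * K)%:R ^+ 2 * (L ^+ 2 + Lmax ^+ 2))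
            * (1 / r.+1%:R),
      forall gamma : 'I_K -> R,
        (forall k, [/\ \rank (A k) = M, 0 < gamma k &
                       gamma k ^+ 2 <= lambda_min (A k *m (A k)^T)]) ->
        forall r : nat,
        Delta r.+1 <=
          3 * Num.max (Delta 0%N)
                (2 * R0 ^+ 2 * (1 / min_blk gamma ^+ 2)
                 * ln (2 * N * K)%:R ^+ 2 * (L ^+ 2 + Lmax ^+ 2))
            * (1 / r.+1%:R) &
      (forall k, \rank (A k) <> N /\ \rank (A k) <> M) ->
        forall r : nat,
        Delta r.+1 <=
          3 * Num.max (Delta 0%N)
                (2 * R0 ^+ 2 * Lmax * (1 + K%:R ^+ 2))
            * (1 / r.+1%:R)].
Proof.
move=> HX [v ov] Hx HR0 /=.
set R0 := R0_radius _ _ _ _ _; set L := lip A; set Lmax := lip_max A.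
have L0 : 0 <= L by exact: lip_ge0.
have gramLmax k w : dot (A k *m w) (A k *m w) <= Lmax * dot w w.
  apply: (le_trans (gram_le_lambda_max _ _)); rewrite ler_wpM2r ?dot_ge0//.
  exact: (le_max_blk (fun k => lambda_max ((A k)^T *m A k))).
have Lmax0 : 0 <= Lmax.
  apply: (le_trans (lambda_max_gram_ge0 (A (Ordinal K_gt0)))).
  exact: (le_max_blk (fun k => lambda_max ((A k)^T *m A k))).
have dist r := bcd_dist_le_radius HX Hx HR0 r.+1 ov.
split.
- move=> sigma Hsigma r.
  have s0 : 0 < min_blk sigma by apply: min_blk_gt0 => // k; case: (Hsigma k).
  apply: (bcd_rate HX Hx ov) => [{}r|]; last exact: rate_constant_ge0.
  set l := ln _; set D := \sum_k _; set s := min_blk sigma.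
  have := cross_sum_le_log A (fun k => x r.+1 k - v k) (fun k => x r.+1 k - x r k).
  have := dist r; rewrite -/R0 -/L.
  set Z := \sum_k _; set Y := \sum_k _ => ZR.
  (* Full column rank converts the step length [Y] into the descent quantity [D]. *)
  have YD : s ^+ 2 * Y <= D.
    rewrite /Y big_distrr; apply: ler_sum => k _.
    apply: le_trans (lambda_min_le_gram _ _); rewrite ler_wpM2r ?dot_ge0//.
    have [_ sk0 sk] := Hsigma k; apply: le_trans sk.
    by rewrite ler_sqr ?nnegrE ?(ltW s0) ?(ltW sk0) ?min_blk_le.
  have := half_up_log_le_ln R N_gt0 K_gt0; rewrite -/l.
  set m := (up_log 2 K)%:R => ml HS.
  have Z0 : 0 <= Z by rewrite sumr_ge0// => k _; exact: dot_ge0.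
  have Y0 : 0 <= Y by rewrite sumr_ge0// => k _; exact: dot_ge0.
  have m0 : 0 <= m by rewrite ler0n.
  have mL : (m * L / 2) ^+ 2 <= l ^+ 2 * (L ^+ 2 + Lmax ^+ 2).
    have : (m * L / 2) ^+ 2 <= (l * L) ^+ 2.
      by rewrite ler_sqr ?nnegrE; nra.
    by have := sqr_ge0 (l * Lmax); lra.
  have YD' : Y <= 1 / s ^+ 2 * D.
    by rewrite mul1r ler_pdivlMl// exprn_gt0.
  have : (m * L / 2) ^+ 2 * Z * Y <=
      l ^+ 2 * (L ^+ 2 + Lmax ^+ 2) * R0 ^+ 2 * (1 / s ^+ 2 * D).
    by rewrite ler_pM// ?mulr_ge0 ?sqr_ge0// ler_pM ?sqr_ge0.
  by move: HS; rewrite /blockdiff; lra.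
- move=> gamma Hgamma r.
  have g0 : 0 < min_blk gamma by apply: min_blk_gt0 => // k; case: (Hgamma k).
  apply: (bcd_rate HX Hx ov) => [{}r|]; last exact: rate_constant_ge0.
  set l := ln _; set D := \sum_k _; set g := min_blk gamma.
  have D0 : 0 <= D by rewrite sumr_ge0// => k _; exact: dot_ge0.
  (* A single block has no cross terms. It is treated apart because [1 <= l] fails for [N = K = 1],
     where [l = ln 2]. *)
  have [K1|K_gt1] := leqP K 1.
    rewrite cross_sum_single// expr0n mulr0 mulr_ge0//.
    exact: rate_constant_ge0.
  (* This trades the factor [K] of [cross_sum_le_lip] for [L / g ^+ 2]. *)
  have KL : K%:R * g ^+ 2 <= L.
    apply: lip_ge_card => // k; have [_ gk0 gk] := Hgamma k; apply: le_trans gk.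
    by rewrite ler_sqr ?nnegrE ?(ltW g0) ?(ltW gk0) ?min_blk_le.
  have {}KL : K%:R <= 1 / g ^+ 2 * L.
    by rewrite mul1r ler_pdivlMl ?exprn_gt0// mulrC.
  have l1 : 1 <= l by exact: ln_dbl_ge1.
  have := cross_sum_le_lip A (fun k => x r.+1 k - v k) (blockdiff A (x r.+1) (x r)).
  have := dist r; rewrite -/R0 -/L -/D.
  set Z := \sum_k _ => ZR HS.
  have Z0 : 0 <= Z by rewrite sumr_ge0// => k _; exact: dot_ge0.
  have L2 : L ^+ 2 <= l ^+ 2 * (L ^+ 2 + Lmax ^+ 2).
    by rewrite -[leLHS]mul1r ler_pM ?sqr_ge0 ?exprn_ege1// lerDl sqr_ge0.
  have : K%:R * L * Z <= 1 / g ^+ 2 * L * L * R0 ^+ 2.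
    by rewrite ler_pM ?mulr_ge0 ?ler0n// ler_wpM2r.
  have : 1 / g ^+ 2 * R0 ^+ 2 * L ^+ 2 <=
      1 / g ^+ 2 * R0 ^+ 2 * (l ^+ 2 * (L ^+ 2 + Lmax ^+ 2)).
    by rewrite ler_wpM2l// mulr_ge0 ?divr_ge0 ?sqr_ge0.
  move: HS; rewrite /blockdiff; set S := cross_sum _ _; set G := 1 / g ^+ 2.
  move=> HS HG HK.
  have : K%:R * L * Z * D <= G * R0 ^+ 2 * (l ^+ 2 * (L ^+ 2 + Lmax ^+ 2)) * D.
    by rewrite ler_wpM2r//; lra.
  lra.
move=> _ r; apply: (bcd_rate HX Hx ov) => [{}r|]; last first.
  by rewrite mulr_ge0 ?addr_ge0 ?exprn_ge0// mulr_ge0// mulr_ge0 ?sqr_ge0.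
have := cross_sum_le_card (blockdiff A (x r.+1) v) (blockdiff A (x r.+1) (x r)).
set S := cross_sum _ _; set E := \sum_k _; set D := \sum_k _ => HS.
have D0 : 0 <= D by rewrite sumr_ge0// => k _; exact: dot_ge0.
have ER : E <= Lmax * R0 ^+ 2.
  apply: (@le_trans _ _ (Lmax * \sum_k dot (x r.+1 k - v k) (x r.+1 k - v k))).
    by rewrite big_distrr; apply: ler_sum => k _; exact: gramLmax.
  by rewrite ler_wpM2l// dist.
have H1 : E * (K%:R ^+ 2 * D) <= Lmax * R0 ^+ 2 * (K%:R ^+ 2 * D).
  by rewrite ler_wpM2r// mulr_ge0 ?sqr_ge0.
(* Passes from the factor [K ^+ 2] to the stated [1 + K ^+ 2]. *)
have H2 : 0 <= Lmax * R0 ^+ 2 * D.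
  by rewrite mulr_ge0// mulr_ge0 ?sqr_ge0.
lra.
Qed.
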